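(* Let $G=(X,E,r)$ be an irreducible finite weighted directed graph. Let $+1,-1\in E$ be a pair of mutually reverse edges between two distinct vertices, $+1: s(+1)\to s(-1)$ and $-1: s(-1)\to s(+1)$, both of nonvanishing weight, and assume that this edge is not a bridge. Then for every $x\in X$, $$r(+1)\,r(-1)\,\dot\tau_{\mathtt 1}\,\tau_x^{\,\mathrm{del}\,\{+1,-1\}}=r(+1)\,\tau_{s(+1)}^{\,\mathrm{del}\,\{+1,-1\}}\,\tau_x^{\,\mathrm{del}\,\{+1\},\ \mathrm{con}\,\{-1\}}+r(-1)\,\tau_{s(-1)}^{\,\mathrm{del}\,\{+1,-1\}}\,\tau_x^{\,\mathrm{del}\,\{-1\},\ \mathrm{con}\,\{+1\}}.$$
   Context: A weighted directed graph $G=(X,E,r)$ consists of a finite vertex set $X$, a set of directed edges $E\subseteq X\times X$ (an ordered pair $(x,y)\in E$ is an edge $x\to y$ with source $x$ and target $y$), and a positive weight $r:E\to\mathbb{R}_{>0}$. The edges $x\to y$ and $y\to x$ may carry different weights. For a subset $S\subseteq E$ write $r(S)=\prod_{e\in S}r(e)$, with $r(\varnothing)=1$. Irreducible means that there is a directed path between any two vertices, in each direction. The source of an edge $e$ is denoted $s(e)$; for a pair of reverse edges $\pm e$, the target of $\pm e$ is $s(\mp e)$. ''Not a bridge'' means that removing both directions $+1,-1$ does not disconnect the graph into two subgraphs. A rooted spanning tree $T_x$ with root $x$ is a set of directed edges forming (when orientations are forgotten) a tree connecting all vertices of $X$, each edge being directed along the unique path leading to the root $x$. Equivalently, it is a spanning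 acyclic set of edges in which every vertex other than $x$ has exactly one outgoing edge and $x$ has none. In particular, it never contains both directions of an edge. For disjoint subsets $A,B\subseteq E$, the conditioned rooted spanning tree polynomial is $$\tau_x^{\,\mathrm{del}\,A,\ \mathrm{con}\,B}=\sum_{\substack{T_x:\ A\cap T_x=\varnothing,\\ B\subseteq T_x}}r(T_x),$$ the sum being over all spanning trees $T_x\subseteq E$ rooted at $x$ that contain no edge of $A$ and contain all edges of $B$ (an empty sum is $0$). When $B=\varnothing$ one writes $\tau_x^{\,\mathrm{del}\,A}$. $\dot\tau_{\mathtt 1}$ denotes the rooted spanning tree polynomial (sum over rooted spanning trees of the product of edge weights) of the weighted directed graph obtained from $G$ by contracting the edges $+1$ and $-1$ to a unique vertex $\mathtt 1$ (identifying $s(+1)$ and $s(-1)$, discarding $\pm1$, and keeping all other edges with their weights, with parallel edges counted separately), with the trees rooted at $\mathtt 1$. *)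

(* Defs.v *)
From mathcomp Require Import all_boot all_order all_algebra.
From mathcomp Require Import reals.

Set Implicit Arguments.
Unset Strict Implicit.
Unset Printing Implicit Defensive.

Import Order.TTheory GRing.Theory Num.Theory.
Local Open Scope ring_scope.

(* Contracting an edge can create parallel edges, so trees are defined for
   directed multigraphs: a finite vertex type V, a finite type I of edge names,
   and maps src tgt : I -> V.  A graph with edge set E inside X * X is the case
   I := X * X, src := fst, tgt := snd; its contraction keeps the same names. *)

Definition dstep (V I : finType) (src tgt : I -> V) (S : {set I}) : rel V :=
  fun u v => [exists e in S, (src e == u) && (tgt e == v)].

(* An edge lies on a directed cycle of S iff its target leads back to its
   source inside S; this covers loops and pairs of reverse edges. *)
Definition acyclic (V I : finType) (src tgt : I -> V) (S : {set I}) : bool :=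
  [forall e in S, ~~ connect (dstep src tgt S) (tgt e) (src e)].

Definition rooted_spanning_tree (V I : finType) (src tgt : I -> V)
    (x : V) (T : {set I}) : bool :=
  acyclic src tgt T &&
  [forall v, #|[set e in T | src e == v]| == (v != x) :> nat].

Definition mtau (R : realType) (V I : finType) (src tgt : I -> V)
    (E : {set I}) (r : I -> R) (del con : {set I}) (x : V) : R :=
  \sum_(T : {set I} | [&& T \subset E, rooted_spanning_tree src tgt x T,
                          [disjoint del & T] & con \subset T])
    \prod_(e in T) r e.

Definition tau (R : realType) (X : finType) (E : {set X * X})
    (r : X * X -> R) (del con : {set X * X}) (x : X) : R :=
  mtau fst snd E r del con x.

Definition irreducible_digraph (X : finType) (E : {set X * X}) : Prop :=
  forall u v : X, connect (dstep fst snd E) u v.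

(* Connectedness of the underlying undirected graph. *)
Definition connected_graph (X : finType) (E : {set X * X}) : Prop :=
  forall u v : X,
    connect [rel a b | ((a, b) \in E) || ((b, a) \in E)] u v.

Definition is_bridge (X : finType) (E : {set X * X}) (ep em : X * X) : Prop :=
  ~ connected_graph (E :\: [set ep; em]).

(* Vertices after merging a and b: None is the merged vertex, and insub is the
   quotient map, sending a and b to None and any other v to Some v. *)
Definition contracted_vertex (X : finType) (a b : X) : finType :=
  option {v : X | v \notin [set a; b]}.

Definition contract (X : finType) (a b v : X) : contracted_vertex a b :=
  insub v.

Definition tau_contracted (R : realType) (X : finType) (E : {set X * X})
    (r : X * X -> R) (ep em : X * X) : R :=
  mtau (fun e => contract ep.1 em.1 e.1) (fun e => contract ep.1 em.1 e.2)
    (E :\: [set ep; em]) r set0 set0 (None : contracted_vertex ep.1 em.1).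

(* Main.v *)
Require Import Defs.
From mathcomp Require Import all_boot all_order all_algebra all_fingroup.
From mathcomp Require Import reals ring.

Set Implicit Arguments.
Unset Strict Implicit.
Unset Printing Implicit Defensive.

Import Order.TTheory GRing.Theory Num.Theory.
Local Open Scope ring_scope.

(** Write [a] and [b] for the sources of +1 and -1, [H] for the graph without
  these two edges, [L] for the Laplacian of [H], [e_v] for the unit row vectors
  and [d := e_b - e_a].

  Every polynomial in the identity is a determinant.  By the matrix-tree
  theorem ([matrix_tree]) the trees of [H] rooted at [x] are counted by [L]
  with row [x] replaced by [e_x] (the matrix [grounded L x]).  Inserting -1
  adds [r(-1) d] to row [b], so by linearity the trees that use -1 but not +1
  are counted by [r(-1)] times the determinant of [grounded L x] with row [b]
  replaced by [d] ([mtau_con_fdet]); likewise for +1, with [- d] in row [a].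
  Finally a tree of the contracted graph rooted at the merged vertex becomes,
  once -1 is put back, a tree of [G] rooted at [a] that uses -1
  ([mtau_contract]), so it is covered by the same formula with [x := a].

  What remains is a quadratic relation between determinants that differ from
  that of [L] in at most three rows ([grounded_exchange]).  The rows of [L] and
  [d] all lie in the hyperplane of vectors with coordinate sum 0.  Modulo the
  other rows, that hyperplane is a plane in which the relation is the
  three-term Pluecker identity between the classes of [L a], [L b], [L x] and
  [d].  It comes from expanding [d] on the rows of [grounded L x] by Cramer's
  rule ([fdet_exchange]).  That expansion is free of denominators, so it also
  covers the graphs [H] without any tree rooted at [x], for which
  [grounded L x] is singular. *)

(** * Determinants of matrices indexed by a finite type *)

Section FinDeterminant.

Variables (R : comNzRingType) (V : finType).
Implicit Types (A B : V -> V -> R) (d : V -> R).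

Definition fmx A : 'M[R]_#|V| := \matrix_(i, j) A (enum_val i) (enum_val j).

(** [fdet A] is independent of the enumeration of [V] that [fmx] uses, since
  the rows and the columns are listed in the same order. *)
Definition fdet A : R := \det (fmx A).

Definition setrow A (v : V) d : V -> V -> R :=
  fun u w => if u == v then d w else A u w.

(** The cofactors of [A] along row [v] do not see that row: this is what makes
  [fdet_setrow] below linear in the new row. *)
Definition fcof A (v w : V) : R := cofactor (fmx A) (enum_rank v) (enum_rank w).

Definition unitvec (v : V) : V -> R := fun w => (v == w)%:R.

Lemma eq_fdet A B : A =2 B -> fdet A = fdet B.
Proof. by move=> eqAB; congr (\det _); apply/matrixP => i j; rewrite !mxE eqAB. Qed.

Lemma big_enum_val (F : V -> R) : \sum_(i < #|V|) F (enum_val i) = \sum_v F v.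
Proof.
rewrite [RHS](reindex (@enum_val V V)) //.
by exists enum_rank => i _; [rewrite enum_valK | rewrite enum_rankK].
Qed.

Lemma fdet_setrow A v d : fdet (setrow A v d) = \sum_w d w * fcof A v w.
Proof.
rewrite /fdet (expand_det_row _ (enum_rank v)) -big_enum_val.
apply: eq_bigr => j _; rewrite mxE /setrow enum_rankK eqxx; congr (_ * _).
rewrite /fcof /cofactor enum_valK; congr (_ * \det _).
apply/matrixP => i k; rewrite !mxE.
case: eqP => // /(congr1 enum_rank); rewrite enum_valK => /esym/eqP.
by rewrite (negPf (neq_lift _ _)).
Qed.

Lemma fdet_setrowDZ A v d1 d2 c :
  fdet (setrow A v (fun w => d1 w + c * d2 w)) =
  fdet (setrow A v d1) + c * fdet (setrow A v d2).
Proof.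
rewrite !fdet_setrow mulr_sumr -big_split /=; apply: eq_bigr => w _.
by rewrite mulrDl mulrA.
Qed.

Lemma fdet_alternate A u v : u != v -> A u =1 A v -> fdet A = 0.
Proof.
move=> neq_uv eqA; apply: (@determinant_alternate _ _ _ (enum_rank u) (enum_rank v)).
  by rewrite (inj_eq enum_rank_inj).
by move=> j; rewrite !mxE !enum_rankK eqA.
Qed.

(** Polarization: the determinant is bilinear in the rows [u] and [v], and
  vanishes when both are [d1 + d2]. *)
Lemma fdet_swap A u v d1 d2 : u != v ->
  fdet (setrow (setrow A u d1) v d2) = - fdet (setrow (setrow A u d2) v d1).
Proof.
move=> neq_uv; apply/eqP; rewrite -addr_eq0; apply/eqP.
have comm e f : fdet (setrow (setrow A u e) v f) = fdet (setrow (setrow A v f) u e).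
  apply: eq_fdet => i j; rewrite /setrow.
  by case: (eqVneq i v) => [->|//]; rewrite eq_sym (negPf neq_uv).
have same e : fdet (setrow (setrow A u e) v e) = 0.
  apply: (fdet_alternate neq_uv) => j.
  by rewrite /setrow !eqxx (negPf neq_uv).
have /esym := same (fun w => d1 w + 1 * d2 w).
rewrite fdet_setrowDZ !comm !fdet_setrowDZ -!comm !same !mul1r addr0 add0r => ->.
by rewrite addrC.
Qed.

(** The adjugate turns [A d = 0] into [fdet A * d v = 0], which settles the
  matter over any commutative ring once some entry of [d] is 1. *)
Lemma fdet_kernel A d v : d v = 1 -> (forall u, \sum_w A u w * d w = 0) ->
  fdet A = 0.
Proof.
move=> dv Ad0; pose D : 'cV[R]_#|V| := \col_i d (enum_val i).
have AD0 : fmx A *m D = 0.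
  apply/matrixP => i j; rewrite !mxE -[RHS](Ad0 (enum_val i)) -big_enum_val.
  by apply: eq_bigr => k _; rewrite !mxE.
have /matrixP/(_ (enum_rank v) 0) : \adj (fmx A) *m (fmx A *m D) = 0.
  by rewrite AD0 mulmx0.
by rewrite mulmxA mul_adj_mx mul_scalar_mx !mxE enum_rankK dv mulr1.
Qed.

(** Cramer's rule: the coordinates of [d] on the rows of [A], cleared of the
  denominator [fdet A], are the determinants of [A] with one row replaced. *)
Lemma fdet_cramer A d w :
  fdet A * d w = \sum_v fdet (setrow A v d) * A v w.
Proof.
pose D : 'rV[R]_#|V| := \row_i d (enum_val i).
have /matrixP/(_ 0 (enum_rank w)) : D *m \adj (fmx A) *m fmx A = fdet A *: D.
  by rewrite -mulmxA mul_adj_mx mul_mx_scalar.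
rewrite !mxE enum_rankK => <-; rewrite -big_enum_val.
apply: eq_bigr => i _; rewrite !mxE enum_rankK; congr (_ * _).
rewrite fdet_setrow -big_enum_val; apply: eq_bigr => j _.
by rewrite !mxE /fcof !enum_valK.
Qed.

(** The determinant of [B] is linear in row [b]; apply this linear form to the
  Cramer expansion of [d] on the rows of [A]. *)
Lemma fdet_exchange A B b d :
  fdet A * fdet (setrow B b d) =
  \sum_v fdet (setrow A v d) * fdet (setrow B b (A v)).
Proof.
rewrite fdet_setrow mulr_sumr.
under eq_bigr do rewrite mulrA fdet_cramer mulr_suml.
rewrite exchange_big; apply: eq_bigr => v _.
by rewrite (fdet_setrow B) mulr_sumr; apply: eq_bigr => w _; rewrite mulrA.
Qed.

(** A matrix that is unitriangular for the preorder of the heights [h].  A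
  permutation [s] that contributes to the determinant has [h (s v) <= h v] for
  all [v]; these inequalities are equalities because both sides have the same
  sum, and then [s] is the identity. *)
Lemma fdet_unitriangular A (h : V -> nat) :
  (forall v, A v v = 1) -> (forall v w, A v w != 0 -> w != v -> (h w < h v)%N) ->
  fdet A = 1.
Proof.
move=> A1 Adec; rewrite /fdet /determinant (bigD1 (1%g : 'S_#|V|)) //= odd_perm1 mul1r.
rewrite big1 => [|i _]; last by rewrite mxE perm1.
rewrite big1 ?addr0 // => s s_neq1.
have [/forallP Anz | ] := boolP [forall i, fmx A i (s i) != 0]; last first.
  rewrite negb_forall => /existsP[i /negPn/eqP Ai0].
  by rewrite (bigD1 i) //= Ai0 mul0r mulr0.
have le_h i : (h (enum_val (s i)) <= h (enum_val i))%N.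
  have := Anz i; rewrite mxE => /Adec.
  by case: (eqVneq (enum_val (s i)) (enum_val i)) => [-> //|_ /(_ isT)/ltnW].
have sum_h : (\sum_(i < #|V|) h (enum_val (s i)) =
             \sum_(i < #|V|) h (enum_val i))%N.
  exact/esym/(reindex_inj (@perm_inj _ s)).
have eq_h i : h (enum_val (s i)) = h (enum_val i).
  have leif_h j : true -> (h (enum_val (s j)) <= h (enum_val j)
      ?= iff (h (enum_val (s j)) == h (enum_val j)))%N by split.
  have [_] := leqif_sum leif_h; rewrite sum_h eqxx => /esym/forallP/(_ i)/eqP.
  by [].
case/eqP: s_neq1; apply/permP => i; rewrite perm1; apply: enum_val_inj.
have := Anz i; rewrite mxE => /Adec.
by case: eqVneq => // _ /(_ isT); rewrite eq_h ltnn.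
Qed.

(** Multilinear expansion when row [v] is a combination of the vectors
  [F v j]: one term for each choice [f] of a summand in every row. *)
Lemma fdet_sum_rows (J : finType) (Q : V -> pred J) (c : V -> J -> R)
    (F : V -> J -> V -> R) :
  fdet (fun v w => \sum_(j | Q v j) c v j * F v j w) =
  \sum_(f in family Q) (\prod_v c v (f v)) * fdet (fun v => F v (f v)).
Proof.
have prod_rank (G : 'I_#|V| -> R) : \prod_i G i = \prod_v G (enum_rank v).
  rewrite (reindex (@enum_rank V)) //.
  by exists enum_val => v _; [rewrite enum_rankK | rewrite enum_valK].
rewrite /fdet /determinant.
transitivity (\sum_(s : 'S_#|V|) \sum_(f in family Q)
    (-1) ^+ s * \prod_v (c v (f v) * F v (f v) (enum_val (s (enum_rank v))))).
  apply: eq_bigr => s _; rewrite -mulr_sumr prod_rank.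
  rewrite -(bigA_distr_big_dep Q
              (fun v f => c v f * F v f (enum_val (s (enum_rank v))))) /=.
  by congr (_ * _); apply: eq_bigr => v _; rewrite mxE enum_rankK.
rewrite exchange_big; apply: eq_bigr => f _ /=.
rewrite mulr_sumr; apply: eq_bigr => s _.
rewrite big_split mulrCA prod_rank; congr (_ * (_ * _)).
by apply: eq_bigr => v _; rewrite mxE enum_rankK.
Qed.

Lemma sum_unitvec (d : V -> R) v : \sum_w unitvec v w * d w = d v.
Proof.
rewrite (bigD1 v) //= big1 => [|w /negPf nwv]; rewrite /unitvec.
  by rewrite eqxx mul1r addr0.
by rewrite eq_sym nwv mul0r.
Qed.

Lemma sum_unitvec1 v : \sum_w unitvec v w = 1.
Proof. by rewrite -[RHS](sum_unitvec (fun=> 1) v); apply: eq_bigr => w _; rewrite mulr1. Qed.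

End FinDeterminant.

(** * The exchange relation for matrices with zero row sums *)

Section ZeroRowSums.

Variables (R : comNzRingType) (V : finType) (L : V -> V -> R).
Hypothesis L_sum0 : forall v, \sum_w L v w = 0.

(** Expanding along row [x] shows that the determinant of this matrix is the
  principal minor of [L] at [x]; keeping the full size lets one compare the
  minors for different [x]. *)
Definition grounded (x : V) : V -> V -> R := setrow L x (unitvec R x).

Definition unitdiff (u v w : V) : R := unitvec R u w - unitvec R v w.

(** Undoing the grounding with a difference of unit vectors leaves a matrix that
  kills the all-one column. *)
Lemma fdet_setrow_root x u v : fdet (setrow (grounded x) x (unitdiff u v)) = 0.
Proof.
apply: (@fdet_kernel _ _ _ (fun=> 1) x) => // y.
under eq_bigr do rewrite mulr1 /grounded /setrow.
case: eqVneq => _; last by exact: L_sum0.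
by rewrite sumrB !sum_unitvec1 subrr.
Qed.

(** The cofactors along a row of [L] are all equal. *)
Lemma fdet_root_move u v : fdet (setrow L v (unitvec R u)) = fdet (grounded v).
Proof.
apply/eqP; rewrite -subr_eq0; apply/eqP; rewrite -[RHS](fdet_setrow_root v u v).
rewrite -mulN1r -fdet_setrowDZ; apply: eq_fdet => y w.
by rewrite /grounded /setrow; case: eqP => // _; rewrite mulN1r.
Qed.

(** In the expansion of [unitdiff b a] on the rows of [grounded L x], a row [L v]
  with [v] outside [a], [b], [x] gives a repeated row in the second factor, and
  the unit row at [x] has coefficient 0 by [fdet_setrow_root].  The rows [L b]
  and [L a] give the two terms on the right.  When [x] is [a] or [b], the term
  of that row is 0 on both sides. *)
Lemma grounded_exchange a b x : a != b ->
  fdet (grounded x) * fdet (setrow (grounded a) b (unitdiff b a)) =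
    fdet (grounded a) * fdet (setrow (grounded x) b (unitdiff b a))
  + fdet (grounded b) * fdet (setrow (grounded x) a (unitdiff a b)).
Proof.
move=> nab; rewrite fdet_exchange (bigD1 b) //= (bigD1 a) //=.
rewrite big1 ?addr0 => [|v /andP[nvb nva]]; last first.
  have [->|nvx] := eqVneq v x; first by rewrite fdet_setrow_root mul0r.
  rewrite [X in _ * X](fdet_alternate nvb) ?mulr0 // => w.
  by rewrite /grounded /setrow eqxx (negPf nvb) (negPf nva) (negPf nvx).
congr (_ + _).
  have [->|nbx] := eqVneq b x; first by rewrite fdet_setrow_root mul0r mulr0.
  rewrite mulrC; congr (_ * _); apply: eq_fdet => u w.
  rewrite /grounded /setrow (negPf nbx); case: eqVneq => // ->.
  by rewrite eq_sym (negPf nab).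
have [->|nax] := eqVneq a x; first by rewrite !fdet_setrow_root mul0r mulr0.
have -> : fdet (setrow (grounded x) a (unitdiff a b)) =
          - fdet (setrow (grounded x) a (unitdiff b a)).
  by rewrite !fdet_setrow -sumrN; apply: eq_bigr => w _; rewrite -mulNr opprB.
rewrite mulrN mulrC -mulNr; congr (_ * _).
(* Here [L a] sits in row [b]; a swap brings it home and leaves [e_a] in row
   [b], where it is as good as [e_b]. *)
rewrite fdet_swap // -(fdet_root_move a b); congr (- _); apply: eq_fdet => u w.
rewrite /grounded /setrow (negPf nax); case: (u == b) => //.
by case: eqP => // ->.
Qed.

End ZeroRowSums.

(** * Rooted spanning trees in multigraphs *)

Section RootedTrees.

Variables (V I : finType) (src tgt : I -> V).
Implicit Types (T : {set I}) (x : V).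

Definition one_out x T : bool :=
  [forall v, #|[set e in T | src e == v]| == (v != x) :> nat].

Lemma one_out_root x T e : one_out x T -> e \in T -> src e != x.
Proof.
move=> /forallP/(_ (src e))/eqP out_e eT; rewrite -[_ != _]lt0b -out_e.
by apply/card_gt0P; exists e; rewrite inE eT eqxx.
Qed.

Lemma one_out_edge x T v : one_out x T -> v != x ->
  exists e, [set e in T | src e == v] = [set e].
Proof. by move=> /forallP/(_ v)/eqP out_v vx; apply/cards1P; rewrite out_v vx. Qed.

Lemma one_out_inj x T e e' :
  one_out x T -> e \in T -> e' \in T -> src e = src e' -> e = e'.
Proof.
move=> outT eT eT' eq_src.
have [e0 def_e0] := one_out_edge outT (one_out_root outT eT).
have: e \in [set e1 in T | src e1 == src e] by rewrite inE eT eqxx.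
have: e' \in [set e1 in T | src e1 == src e'] by rewrite inE eT' eqxx.
by rewrite -eq_src def_e0 => /set1P-> /set1P->.
Qed.

Lemma dstepP T u v :
  reflect (exists2 e, e \in T & src e = u /\ tgt e = v) (dstep src tgt T u v).
Proof.
apply: (iffP existsP) => [[e /and3P[eT /eqP eu /eqP ev]]|[e eT [<- <-]]].
  by exists e.
by exists e; rewrite eT !eqxx.
Qed.

Lemma connect_edge T e : e \in T -> connect (dstep src tgt T) (src e) (tgt e).
Proof. by move=> eT; apply/connect1/dstepP; exists e. Qed.

(** An edge of [T] is the only exit from its source, so a path from there to
  elsewhere begins with it. *)
Lemma one_out_connect x T e v : one_out x T -> e \in T -> src e != v ->
  connect (dstep src tgt T) (src e) v = connect (dstep src tgt T) (tgt e) v.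
Proof.
move=> outT eT neq_v; apply/idP/idP => [|]; last first.
  exact/connect_trans/connect_edge.
case/connectP=> [[|w p] /= wp def_v]; first by rewrite def_v eqxx in neq_v.
case/andP: wp => /dstepP[e' eT' [eq_src tgt_w]] wp.
have eqe := one_out_inj outT eT eT' (esym eq_src).
by apply/connectP; exists p; rewrite eqe tgt_w.
Qed.

Lemma one_out_from_root x T v :
  one_out x T -> connect (dstep src tgt T) x v = (v == x).
Proof.
move=> outT; apply/idP/eqP => [/connectP[[|w p] //= /andP[/dstepP[e eT [es _]] _]]|-> //].
by have := one_out_root outT eT; rewrite es eqxx.
Qed.

Definition reaches x T : bool := [forall v, connect (dstep src tgt T) v x].

(** The number of vertices reachable from a vertex is the height function both
  for the induction towards the root and for the triangularity of the
  Laplacian of a tree. *)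
Lemma acyclic_descent T e : acyclic src tgt T -> e \in T ->
  (#|connect (dstep src tgt T) (tgt e)| < #|connect (dstep src tgt T) (src e)|)%N.
Proof.
move=> /forall_inP acT eT; apply/proper_card/properP; split.
  by apply/subsetP => w; apply: connect_trans (connect_edge eT).
by exists (src e); [apply: connect0 | apply: acT].
Qed.

(** Following the unique exits from any vertex ends at the root or in a cycle.
  If [e] lies on a cycle, then everything reachable from its source leads back
  to it; were the root reachable, it would have an exit. *)
Lemma acyclic_reaches x T : one_out x T -> acyclic src tgt T = reaches x T.
Proof.
move=> outT; apply/idP/forallP => [acT v|reachT]; last first.
  apply/forall_inP => e eT; apply/negP => back_e.
  have recur w : connect (dstep src tgt T) (src e) w ->
                 connect (dstep src tgt T) w (src e).
    case/connectP => p; elim/last_ind: p w => [|p u IHp] w /=; first by move=> _ ->.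
    rewrite rcons_path last_rcons => /andP[src_p /dstepP[e' eT' [es' et']]] ->.
    have [eq_src|neq_src] := eqVneq (src e') (src e).
      by rewrite -et' (one_out_inj outT eT' eT eq_src).
    by rewrite -et' -(one_out_connect outT eT' neq_src) es'; apply: IHp.
  have := recur x (reachT _); rewrite (one_out_from_root _ outT).
  by rewrite (negPf (one_out_root outT eT)).
have [n] := ubnP #|connect (dstep src tgt T) v|.
elim: n v => // n IHn v; rewrite ltnS => le_n.
have [-> //|/(one_out_edge outT)[e /setP/(_ e)]] := eqVneq v x.
rewrite !inE eqxx => /andP[eT /eqP es]; rewrite -es in le_n *.
apply: connect_trans (connect_edge eT) _; apply/IHn/(leq_trans _ le_n).
exact: acyclic_descent.
Qed.

Lemma rooted_spanning_treeE x T :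
  rooted_spanning_tree src tgt x T = one_out x T && reaches x T.
Proof.
rewrite /rooted_spanning_tree andbC -/(one_out x T).
by case outT: (one_out x T); rewrite //= (acyclic_reaches outT).
Qed.

Variable R : comNzRingType.
Implicit Types (r : I -> R) (E : {set I}).

Definition laplacian E r (v w : V) : R :=
  \sum_(e in E | src e == v) r e * (unitvec R v w - unitvec R (tgt e) w).

Lemma sum_laplacian E r v (d : V -> R) :
  \sum_w laplacian E r v w * d w =
  \sum_(e in E | src e == v) r e * (d v - d (tgt e)).
Proof.
under eq_bigr do rewrite mulr_suml.
rewrite exchange_big; apply: eq_bigr => e _ /=.
under eq_bigr do rewrite -mulrA mulrBl.
by rewrite -mulr_sumr sumrB !sum_unitvec.
Qed.

Lemma laplacian_sum0 E r v : \sum_w laplacian E r v w = 0.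
Proof.
under eq_bigr do rewrite -[laplacian _ _ _ _]mulr1.
rewrite (sum_laplacian _ _ _ (fun=> 1)) big1 // => e _.
by rewrite subrr mulr0.
Qed.

Lemma laplacian_tree x T v e w : one_out x T -> e \in T -> src e = v ->
  laplacian T (fun=> 1) v w = unitvec R v w - unitvec R (tgt e) w.
Proof.
move=> outT eT <-; rewrite /laplacian (big_pred1 e) ?mul1r // => e'.
apply/andP/eqP => [[eT' /eqP]|->]; last by rewrite eT eqxx.
exact: one_out_inj outT eT' eT.
Qed.

(** If every vertex reaches the root, the matrix is unitriangular by
  [acyclic_descent].  Otherwise the indicator of the vertices that do not reach
  the root is a kernel vector: an edge joins two vertices of the same kind. *)
Lemma fdet_one_out x T : one_out x T ->
  fdet (grounded (laplacian T (fun=> 1)) x) = (reaches x T)%:R.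
Proof.
move=> outT; have [|] := boolP (reaches x T).
  rewrite -(acyclic_reaches outT) => acT.
  apply: (@fdet_unitriangular _ _ _ (fun v => #|connect (dstep src tgt T) v|)).
    move=> v; rewrite /grounded /setrow; case: eqVneq => [->|].
      by rewrite /unitvec eqxx.
    case/(one_out_edge outT) => e /setP/(_ e); rewrite !inE eqxx.
    case/andP => eT /eqP es; rewrite (laplacian_tree _ outT eT es) /unitvec eqxx.
    case: eqP => [ev|]; last by rewrite subr0.
    by have := acyclic_descent acT eT; rewrite es ev ltnn.
  move=> v w; rewrite /grounded /setrow; case: (eqVneq v x) => [->|].
    by rewrite /unitvec [x == w]eq_sym; case: (w == x); rewrite ?eqxx.
  case/(one_out_edge outT) => e /setP/(_ e); rewrite !inE eqxx.
  case/andP => eT /eqP es; rewrite (laplacian_tree _ outT eT es) /unitvec.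
  rewrite [v == w]eq_sym => /[swap]/negPf->;
    case: (eqVneq (tgt e) w) => [<- _|_]; last by rewrite subrr eqxx.
  by rewrite -es; apply: acyclic_descent.
rewrite negb_forall => /existsP[v not_v].
apply: (@fdet_kernel _ _ _ (fun w => (~~ connect (dstep src tgt T) w x)%:R) v).
  by rewrite not_v.
move=> u; rewrite /grounded /setrow; case: eqVneq => [_|].
  by rewrite sum_unitvec connect0.
case/(one_out_edge outT) => e /setP/(_ e); rewrite !inE eqxx.
case/andP => eT /eqP es; rewrite sum_laplacian big1 // => e' /andP[eT' /eqP <-].
rewrite (one_out_connect outT) ?subrr ?mulr0 //.
exact: one_out_root eT'.
Qed.

Section Choices.

Variables (x : V) (E : {set I}).

(** A summand of row [v] of the grounded Laplacian: an exit of [v], or [None] for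
  the single unit vector in the row of the root. *)
Definition choices (v : V) : pred (option I) :=
  fun o => if o is Some e then [&& v != x, e \in E & src e == v] else v == x.

Definition chosen_edges (f : {ffun V -> option I}) : {set I} :=
  [set e | f (src e) == Some e].

Definition edge_choice (T : {set I}) : {ffun V -> option I} :=
  [ffun v => [pick e in T | src e == v]].

Lemma sum_choices (v : V) (F : option I -> R) :
  \sum_(o | choices v o) F o =
  if v == x then F None else \sum_(e in E | src e == v) F (Some e).
Proof.
rewrite /choices; have [->|nvx] := eqVneq v x.
  by rewrite (big_pred1 None) //; case=> //=; rewrite eqxx.
rewrite (reindex_omap Some id) => [|[]//].
by apply: eq_bigl => e /=; rewrite eqxx andbT.
Qed.

Lemma chosen_edgesK f : f \in family choices -> edge_choice (chosen_edges f) = f.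
Proof.
move=> /familyP fQ; apply/ffunP => v; rewrite ffunE.
case: pickP => [e|none].
  by rewrite inE => /andP[/eqP fe /eqP<-].
have := fQ v; rewrite /choices unfold_in; case fv: (f v) => [e|] //.
case/and3P => _ _ /eqP es; have := none e.
by rewrite inE es fv !eqxx.
Qed.

Lemma chosen_edges_out f v : f \in family choices ->
  #|[set e in chosen_edges f | src e == v]| = (v != x).
Proof.
move=> /familyP/(_ v); rewrite /choices unfold_in; case fv: (f v) => [e|].
  case/and3P => -> _ /eqP es; apply/eqP/cards1P; exists e; apply/setP => e'.
  rewrite !inE; apply/andP/eqP => [[/eqP fe' /eqP ev]|->].
    by move: fe'; rewrite ev fv => -[].
  by rewrite es fv !eqxx.
move=> ->; apply/eqP; rewrite cards_eq0; apply/eqP/setP => e; rewrite !inE.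
by apply/negbTE/negP => /andP[/eqP + /eqP ev]; rewrite ev fv.
Qed.

Lemma chosen_edges_sub f : f \in family choices -> chosen_edges f \subset E.
Proof.
move=> /familyP fQ; apply/subsetP => e; rewrite inE => /eqP fe.
by have := fQ (src e); rewrite /choices unfold_in fe => /and3P[].
Qed.

Lemma edge_choiceK T : one_out x T -> chosen_edges (edge_choice T) = T.
Proof.
move=> outT; apply/setP => e; rewrite inE ffunE.
case: pickP => [e' /andP[eT' /eqP es]|none]; last first.
  by have := none e; rewrite eqxx andbT => ->.
apply/eqP/idP => [[<-]//|eT]; congr Some; exact: one_out_inj outT eT' eT es.
Qed.

Lemma edge_choice_family T :
  T \subset E -> one_out x T -> edge_choice T \in family choices.
Proof.
move=> /subsetP sTE outT; apply/familyP => v; rewrite ffunE /choices unfold_in.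
case: pickP => [e /andP[eT /eqP es]|none].
  by rewrite -es (one_out_root outT eT) sTE //=.
apply/contraT => /(one_out_edge outT)[e /setP/(_ e)].
by rewrite !inE none eqxx.
Qed.

End Choices.

(** Tutte's directed matrix-tree theorem.  Expand every row over the exits of
  its vertex: the choices of exits are the edge sets with [one_out], and such a
  set contributes its weight times the determinant of its own Laplacian, which
  [fdet_one_out] says is 1 for a tree and 0 otherwise. *)
Theorem matrix_tree x E r :
  fdet (grounded (laplacian E r) x) =
  \sum_(T : {set I} | (T \subset E) && rooted_spanning_tree src tgt x T)
    \prod_(e in T) r e.
Proof.
pose F (v : V) (o : option I) (w : V) : R :=
  if o is Some e then unitvec R v w - unitvec R (tgt e) w else unitvec R v w.
transitivity (fdet (fun v w => \sum_(o | choices x E v o) oapp r 1 o * F v o w)).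
  apply: eq_fdet => v w; rewrite sum_choices /grounded /setrow /=.
  by case: eqP => // <-; rewrite mul1r.
rewrite fdet_sum_rows.
transitivity (\sum_(T : {set I} | (T \subset E) && one_out x T)
    (\prod_(e in T) r e) * (reaches x T)%:R); last first.
  rewrite [LHS](bigID (reaches x)) /= [X in _ + X]big1 => [|T /andP[_ /negPf->]];
    last by rewrite mulr0.
  rewrite addr0; apply: eq_big => [T|T /andP[_ ->]]; last by rewrite mulr1.
  by rewrite rooted_spanning_treeE andbA.
rewrite [RHS](reindex_onto chosen_edges edge_choice) /=; last first.
  by move=> T /andP[_ outT]; apply: edge_choiceK outT.
apply: eq_big => [f|f fQ].
  apply/idP/andP => [fQ|[/andP[subE outf] /eqP <-]].
    rewrite (chosen_edgesK fQ) (chosen_edges_sub fQ); split=> //.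
    by apply/forallP => v; rewrite (chosen_edges_out v fQ).
  exact: edge_choice_family.
have outf : one_out x (chosen_edges f).
  by apply/forallP => v; rewrite (chosen_edges_out v fQ).
congr (_ * _).
  rewrite (partition_big src predT) //=; apply: eq_bigr => v _.
  have /familyP/(_ v) := fQ; rewrite unfold_in /choices.
  case fv: (f v) => [e|] /=.
    case/and3P=> _ _ /eqP es; rewrite (big_pred1 e) // => e'.
    rewrite inE; apply/andP/eqP => [[/eqP + /eqP ev]|->].
      by rewrite ev fv => -[].
    by rewrite es fv !eqxx.
  move=> _; rewrite big_pred0 // => e; rewrite inE.
  by apply/negP => /andP[/eqP + /eqP ev]; rewrite ev fv.
rewrite -fdet_one_out //; apply: eq_fdet => v w.
have /familyP/(_ v) := fQ; rewrite unfold_in /choices /grounded /setrow.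
case fv: (f v) => [e|] /=; last by move/eqP->; rewrite eqxx.
case/and3P=> /negPf-> _ /eqP es; rewrite (laplacian_tree _ outf _ es) //.
by rewrite inE es fv.
Qed.

End RootedTrees.

(** * Contracting an edge *)

Section Contraction.

Variables (V I : finType) (src tgt : I -> V) (a b : V).
Hypothesis neq_ab : a != b.

Local Notation q := (contract a b).
Local Notation qsrc := (fun e => q (src e)).
Local Notation qtgt := (fun e => q (tgt e)).

Lemma contract_eqNone v : (q v == None) = (v \in [set a; b]).
Proof. by rewrite /contract; case: insubP => [u /negPf->|/negPn->]. Qed.

Lemma contract_eq v v' : v \notin [set a; b] -> (q v' == q v) = (v' == v).
Proof.
move=> v_ab; rewrite {2}/contract insubT /contract.
case: insubP => [u _ <-|/negPn v'_ab]; first by [].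
by apply/esym/negbTE; apply: contraNneq v_ab => <-.
Qed.

Lemma contract_surj w : exists v, q v = w.
Proof.
case: w => [u|]; first by exists (val u); rewrite /contract valK.
by exists a; apply/eqP; rewrite contract_eqNone set21.
Qed.

Variables (e0 : I) (T : {set I}).
Hypotheses (src_e0 : src e0 = b) (tgt_e0 : tgt e0 = a) (e0T : e0 \notin T).

(** The meeting point of the two out-degree conditions: contraction makes the
  root out of [a] and [b], and adding [e0] gives [b] its only exit. *)
Let forest_out :=
  [forall v, #|[set e in T | src e == v]| == (v \notin [set a; b]) :> nat].

Lemma one_out_contract : one_out qsrc None T = forest_out.
Proof.
apply/forallP/forallP => outT.
  move=> v; have [v_ab|v_ab] := boolP (v \in [set a; b]).
    have := outT None; rewrite eqxx /= !cards_eq0 -!subset0; apply: subset_trans.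
    by apply/subsetP => e; rewrite !inE contract_eqNone => /andP[-> /eqP->].
  have := outT (q v); rewrite contract_eqNone v_ab.
  by congr (#|pred_of_set _| == _); apply/setP => e; rewrite !inE contract_eq.
move=> w; have [v <-] := contract_surj w; rewrite contract_eqNone.
have [v_ab|v_ab] := boolP (v \in [set a; b]); last first.
  have := outT v; rewrite v_ab.
  by congr (#|pred_of_set _| == _); apply/setP => e; rewrite !inE contract_eq.
rewrite cards_eq0; apply/eqP/setP => e; rewrite !inE.
apply/negP => /andP[eT]; move: v_ab; rewrite -contract_eqNone => /eqP->.
rewrite contract_eqNone => s_ab; have := outT (src e); rewrite s_ab cards_eq0.
by move/eqP/setP/(_ e); rewrite !inE eT eqxx.
Qed.

Lemma one_out_extend : one_out src a (e0 |: T) = forest_out.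
Proof.
apply: eq_forallb => v.
have -> : #|[set e in e0 |: T | src e == v]| =
          ((b == v) + #|[set e in T | src e == v]|)%N.
  have [<-|nbv] := eqVneq b v.
    transitivity #|e0 |: [set e in T | src e == b]|; last first.
      by rewrite cardsU1 inE (negPf e0T).
    congr #|pred_of_set _|; apply/setP => e; rewrite !inE.
    by case: eqVneq => // ->; rewrite src_e0 eqxx.
  congr #|pred_of_set _|; apply/setP => e; rewrite !inE.
  by case: eqVneq => // ->; rewrite src_e0 (negPf nbv) !andbF.
rewrite !inE; have [<-|nbv] := eqVneq b v.
  by rewrite [b == a]eq_sym (negPf neq_ab).
by rewrite add0n orbF.
Qed.

(** A step of [T] in the quotient lifts to the source of its edge, except at the
  merged vertex, where the walk may stop; the edge [e0] then closes the gap
  from [b] to [a]. *)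
Lemma reaches_contract : reaches qsrc qtgt None T = reaches src tgt a (e0 |: T).
Proof.
apply/forallP/forallP => reachT.
  move=> v; have /connectP[p] := reachT (q v); elim: p v => [|w p IHp] v /=.
    move=> _ /esym/eqP; rewrite contract_eqNone => /set2P[->|->] //.
    by rewrite -src_e0 -tgt_e0; apply/connect_edge/setU11.
  have [qv _ _|qv] := eqVneq (q v) None.
    move/eqP: qv; rewrite contract_eqNone => /set2P[->|->] //.
    by rewrite -src_e0 -tgt_e0; apply/connect_edge/setU11.
  case/andP=> /dstepP[e eT [/eqP]].
  rewrite contract_eq -?contract_eqNone // => /eqP <- <- pth lst.
  apply: connect_trans (IHp _ pth lst).
  by apply/connect_edge/setU1r.
move=> w; have [v <-] := contract_surj w.
have /connectP[p] := reachT v; elim: p v => [|u p IHp] v /=.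
  by move=> _ <-; rewrite (_ : q a = None) //; apply/eqP; rewrite contract_eqNone set21.
case/andP=> /dstepP[e eT [es et]] pth lst.
have {IHp} := IHp _ pth lst; case/setU1P: eT => [e_e0|eT].
  rewrite -es -et e_e0 src_e0 tgt_e0 => _.
  by rewrite (_ : q b = None) //; apply/eqP; rewrite contract_eqNone set22.
by apply: connect_trans; rewrite -es -et; apply: (@connect_edge _ _ qsrc qtgt).
Qed.

Lemma rooted_spanning_tree_contract :
  rooted_spanning_tree qsrc qtgt None T =
  rooted_spanning_tree src tgt a (e0 |: T).
Proof.
by rewrite !rooted_spanning_treeE one_out_contract one_out_extend reaches_contract.
Qed.

End Contraction.

(** * Tree polynomials as determinants *)

Section TreePolynomials.

Variables (R : realType) (V I : finType) (src tgt : I -> V).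
Implicit Types (E D : {set I}) (r : I -> R) (x : V).

(** The bijection adds [e] to a tree of the contracted graph.  The other edges
  out of [src e] do no harm on the contracted side: they leave the root there,
  so that no tree contains them. *)
Lemma mtau_contract E D r (e : I) :
  e \in E -> e \notin D -> tgt e != src e ->
  r e * mtau (fun e' => contract (tgt e) (src e) (src e'))
             (fun e' => contract (tgt e) (src e) (tgt e'))
             (E :\: (e |: D)) r set0 set0 None =
  mtau src tgt E r D [set e] (tgt e).
Proof.
move=> eE eD neq_e; rewrite /mtau mulr_sumr.
rewrite [RHS](reindex_onto (fun T => e |: T) (fun T => T :\ e)) /=; last first.
  by move=> T /and4P[_ _ _]; rewrite sub1set; apply: setD1K.
apply: eq_big => [T|T /andP[]]; last first.
  rewrite subsetD disjoint_sym disjoints_subset => /andP[_ /subsetP/(_ e)].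
  by rewrite !inE eqxx => /(_ isT) eT _; rewrite big_setU1.
rewrite subsetD sub0set disjoint_sym -!setI_eq0 set0I eqxx !andbT.
rewrite sub1set setU11 andbT subUset sub1set eE /=.
have [eT|eT] := boolP (e \in T).
  transitivity false; last first.
    apply/esym/negbTE/negP => /andP[_ /eqP/setP/(_ e)].
    by rewrite !inE eqxx eT.
  apply/negbTE/negP => /andP[/andP[_ /eqP/setP/(_ e) e_in] _].
  by move: e_in; rewrite !inE eqxx eT.
rewrite setU1K // eqxx andbT (@rooted_spanning_tree_contract _ _ _ _ _ _ _ e) //.
rewrite -andbA; congr (_ && _); rewrite andbC; congr (_ && _).
apply/eqP/eqP => /setP dis; apply/setP => e'; have := dis e'; rewrite !inE.
  by case: (eqVneq e' e) => [->|_] //; rewrite (negPf eD).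
by case: (eqVneq e' e) => [->|_] //; rewrite (negPf eT).
Qed.

Lemma mtau_fdet E D r x :
  mtau src tgt E r D set0 x = fdet (grounded (laplacian src tgt (E :\: D) r) x).
Proof.
rewrite matrix_tree; apply: eq_bigl => T.
by rewrite sub0set subsetD disjoint_sym andbT andbAC -andbA.
Qed.

Lemma mtau_split E D r x e : e \notin D ->
  mtau src tgt E r D set0 x =
  mtau src tgt E r (e |: D) set0 x + mtau src tgt E r D [set e] x.
Proof.
move=> eD; rewrite /mtau (bigID (fun T : {set I} => e \notin T)) /=.
congr (_ + _); apply: eq_bigl => T; rewrite !sub0set ?sub1set ?negbK !andbT -!andbA //.
by do 3!congr (_ && _); rewrite -!setI_eq0 setIUl setU_eq0 !setI_eq0 disjoints1 andbC.
Qed.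

Lemma mtau_con_root E D r e : mtau src tgt E r D [set e] (src e) = 0.
Proof.
rewrite /mtau big_pred0 // => T; apply/negP => /and4P[_ + _].
rewrite rooted_spanning_treeE sub1set => /andP[outT _] /(one_out_root outT).
by rewrite eqxx.
Qed.

(** Deleting [e] or not changes the Laplacian in row [src e] only, by
  [r e * unitdiff (src e) (tgt e)]; the determinant is linear in that row, and
  [mtau_split] isolates the trees through [e].  If [x] is the source of [e],
  there are none, and the determinant is 0 as well. *)
Lemma mtau_con_fdet E D r x e : e \in E -> e \notin D ->
  mtau src tgt E r D [set e] x =
  r e * fdet (setrow (grounded (laplacian src tgt (E :\: (e |: D)) r) x) (src e)
                (unitdiff R (src e) (tgt e))).
Proof.
move=> eE eD; set A := grounded _ _; set d := unitdiff _ _ _.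
have [xs|nsx] := eqVneq x (src e).
  rewrite {1}xs mtau_con_root /A xs fdet_setrow_root ?mulr0 // => v.
  exact: laplacian_sum0.
have := mtau_split E r x eD; rewrite !mtau_fdet -/A.
rewrite (@eq_fdet _ _ _ (setrow A (src e) (fun w => A (src e) w + r e * d w))).
  rewrite fdet_setrowDZ (@eq_fdet _ _ (setrow A (src e) (A (src e))) A) => [|u w].
    by move=> /addrI.
  by rewrite /setrow; case: eqP => // ->.
have -> : E :\: D = e |: (E :\: (e |: D)).
  by apply/setP => e'; rewrite !inE; case: (eqVneq e' e) => // ->; rewrite eD.
move=> u w; rewrite /A /grounded /setrow.
have e_new : e \notin E :\: (e |: D) by rewrite !inE eqxx.
case: (eqVneq u x) => [->|nux].
  by rewrite (negPf nsx).
case: (eqVneq u (src e)) nux => [->|nus] nux.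
  rewrite (negPf nux) /laplacian big_mkcondr big_setU1 //= eqxx addrC.
  by rewrite -big_mkcondr.
rewrite /laplacian big_mkcondr big_setU1 //= eq_sym (negPf nus) add0r.
by rewrite -big_mkcondr.
Qed.

End TreePolynomials.

(** * The deletion-contraction identity *)

Theorem theorem2 (R : realType) (X : finType) (E : {set X * X})
    (r : X * X -> R) (ep em : X * X)
    (r_gt0 : forall e, e \in E -> 0 < r e)
    (E_irr : irreducible_digraph E)
    (ep_in : ep \in E) (em_in : em \in E)
    (ep_tgt : ep.2 = em.1) (em_tgt : em.2 = ep.1)
    (src_neq : ep.1 <> em.1)
    (rp_neq0 : r ep <> 0) (rm_neq0 : r em <> 0)
    (not_bridge : ~ is_bridge E ep em)
    (x : X) :
  r ep * r em * tau_contracted E r ep em * tau E r [set ep; em] set0 x =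
    r ep * tau E r [set ep; em] set0 ep.1 * tau E r [set ep] [set em] x
  + r em * tau E r [set ep; em] set0 em.1 * tau E r [set em] [set ep] x.
Proof.
have neq_ab : ep.1 != em.1 by apply/eqP.
have neq_e : ep != em by apply: contraNneq neq_ab => ->.
set H := E :\: [set ep; em]; set L := laplacian fst snd H r.
have L_sum0 v : \sum_w L v w = 0 by apply: laplacian_sum0.
have tau_del y : tau E r [set ep; em] set0 y = fdet (grounded L y).
  exact: mtau_fdet.
have tau_em y : tau E r [set ep] [set em] y =
    r em * fdet (setrow (grounded L y) em.1 (unitdiff R em.1 ep.1)).
  rewrite /tau mtau_con_fdet ?inE 1?eq_sym //.
  by rewrite setUC /L /H em_tgt.
have tau_ep y : tau E r [set em] [set ep] y =
    r ep * fdet (setrow (grounded L y) ep.1 (unitdiff R ep.1 em.1)).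
  by rewrite /tau mtau_con_fdet ?inE // ep_tgt.
have tau_ctr : r em * tau_contracted E r ep em = tau E r [set ep] [set em] ep.1.
  have := @mtau_contract R X _ fst snd E [set ep] r em em_in.
  by rewrite inE eq_sym neq_e em_tgt neq_ab setUC => /(_ isT isT).
rewrite -[r ep * r em * _]mulrA tau_ctr !tau_em tau_ep !tau_del.
have exch := grounded_exchange L_sum0 x neq_ab.
rewrite -[r ep * (_ * _) * _]mulrA -[r em * _ * fdet _]mulrA.
rewrite [fdet (setrow (grounded L ep.1) _ _) * _]mulrC exch.
by ring.
Qed.
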